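(* For all sufficiently large real $r$, $$C_r \le \frac12\exp\left[\frac12\,\frac{r^{20/9}}{(\log r)^{29/9}}\left(1+\frac{\log\log r}{\log r-\log\log r}+\frac{O(1)}{\log r}\right)\right].$$ That is, there exist constants $A>0$ and $R>1$ such that for all $r\ge R$ the inequality holds with $O(1)$ replaced by $A$.
   Context: For real $r>1$ and a positive integer $n$, $\sigma_{-r}(n)=\sum_{d\mid n} d^{-r}$, the sum being over positive divisors of $n$. $C_r$ denotes the number of connected components of $\overline{\sigma_{-r}(\mathbb{N})}$, the topological closure in $\mathbb{R}$ of the range $\{\sigma_{-r}(n): n\in\mathbb{N}\}$, where $\mathbb{N}=\{1,2,\dots\}$. $\log$ is the natural logarithm. *)

(* Defs.v *)
From HB Require Import structures.
From mathcomp Require Import all_boot all_order all_algebra.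
From mathcomp Require Import all_classical all_reals all_analysis.
Set Implicit Arguments.
Unset Strict Implicit.
Unset Printing Implicit Defensive.
Import Order.TTheory GRing.Theory Num.Theory.
Import numFieldNormedType.Exports.
Local Open Scope classical_set_scope.
Local Open Scope ring_scope.

Definition sigma_neg {R : realType} (r : R) (n : nat) : R :=
  \sum_(d <- divisors n) d%:R `^ (- r).

(* 0 is excluded: [divisors 0 = [::]] would add the spurious value 0. *)
Definition sigma_range {R : realType} (r : R) : set R :=
  sigma_neg r @` [set n | (0 < n)%N].

Definition components {T : topologicalType} (A : set T) : set (set T) :=
  connected_component A @` A.

(* Extended-real valued: [counting] is [+oo] on infinite sets, so an upper
   bound by a finite quantity also asserts that there are finitely many
   components. *)
Definition nb_components {R : realType} (r : R) : \bar R :=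
  counting (components (closure (sigma_range r))).

(* Main.v *)
Require Import Defs.
From HB Require Import structures.
From mathcomp Require Import all_boot all_order all_algebra.
From mathcomp Require Import all_classical all_reals all_analysis.
From mathcomp Require Import zify ring lra.
Set Implicit Arguments.
Unset Strict Implicit.
Unset Printing Implicit Defensive.
Import Order.TTheory GRing.Theory Num.Theory.
Import numFieldNormedType.Exports.
Local Open Scope classical_set_scope.
Local Open Scope ring_scope.

(** Write K for the closure of the range of sigma_{-r}.  The bound comes from a
    covering argument: every point of the range lies in a segment contained in
    K whose length is at least some fixed delta > 0.  As K lies in [1, 2], about
    1/delta grid points of mesh delta meet all these segments, so the components
    of K through grid points cover the range.  They are finitely many closed
    sets, hence they also cover K, and K has O(1/delta) components
    ([counting_components_closure_le]).

    The segments come from factoring n = m l, where l collects the prime factors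
    of n that are at least P.  If sigma_{-r} of the P-rough numbers is dense in
    [1, sup], then scaling by sigma_{-r}(m) gives a segment of K around
    sigma_{-r}(n), of length at least P^(-r) ([long_segment]).  Density is
    Kakeya's greedy expansion over the primes p >= P ([greedy_approx]); it works
    as soon as the factor 1 + p^(-r) never exceeds what the primes beyond p can
    produce together ([outweighed]).

    That condition only asks for many primes at moderate distance from p: with
    x = p L, it is enough that the number of primes in (p, x] exceeds L^r.
    Chebyshev's lower bound pi(x) >= c x / log x, read off from a row
    sum of Pascal's triangle ([two_exp_le_primes]), provides p such primes for
    L of order log p, so p > L^r suffices, i.e. log p a little above r log r.
    Taking P = 2^U with U about r^(6/5) is ample ([many_primes]), and then
    1/delta = P^r = exp(O(r^(11/5))).  Since 11/5 < 20/9, this is eventually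
    smaller than the required bound, powers of log r included
    ([exponent_le]). *)

(** * Prime factors of binomial coefficients *)

Section ManyPrimes.
Local Open Scope nat_scope.

Lemma sum_leq_nat (t m : nat) : \sum_(1 <= i < m.+1) (i <= t) <= t.
Proof.
elim: m => [|m IH]; first by rewrite big_geq.
rewrite big_nat_recr //=; case: (ltnP m t) => /= [lt_mt|_]; last by rewrite addn0.
apply: leq_trans lt_mt; rewrite addn1 ltnS.
apply: leq_trans (_ : (\sum_(1 <= i < m.+1) 1) <= m).
  by apply: leq_sum => i _; apply: leq_b1.
by rewrite sum_nat_const_nat muln1 subn1.
Qed.

(** In Legendre's formula each power p^i contributes at most one to the
    exponent (a carry), and nothing once p^i > m. *)
Lemma logn_bin_le (p m k : nat) : prime p -> k <= m ->
  logn p 'C(m, k) <= trunc_log p m.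
Proof.
move=> p_pr le_km; have p_gt1 := prime_gt1 p_pr.
(* Extending Legendre's sum to a common range makes the three sums comparable. *)
have ext a : a <= m -> logn p a`! = \sum_(1 <= i < m.+1) a %/ p ^ i.
  move=> le_am; rewrite logn_fact // [RHS](big_cat_nat (n := a.+1)) //=.
  rewrite [X in _ = _ + X]big_nat_cond [X in _ = _ + X]big1 ?addn0 // => i.
  rewrite andbT => /andP[lt_ai _]; apply: divn_small.
  exact: leq_trans lt_ai (ltnW (ltn_expl i p_gt1)).
have C_gt0 : 0 < 'C(m, k) by rewrite bin_gt0.
have /(congr1 (logn p)) := bin_fact le_km.
rewrite !lognM ?muln_gt0 ?fact_gt0 // !ext ?leq_subr // -big_split /= => eqC.
have : \sum_(1 <= i < m.+1) m %/ p ^ i <=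
    \sum_(1 <= i < m.+1) (k %/ p ^ i + (m - k) %/ p ^ i)
     + \sum_(1 <= i < m.+1) (i <= trunc_log p m).
  rewrite -big_split /=; apply: leq_sum => i _.
  rewrite -{1}(subnKC le_km) divnD ?expn_gt0 ?prime_gt0 // leq_add2l.
  case: (leqP i) => [_|lt_ti]; first exact: leq_b1.
  rewrite leqn0 eqb0 -ltnNge.
  have lt_m : m < p ^ i.
    by apply: leq_trans (trunc_log_ltn m p_gt1) _; rewrite leq_exp2l.
  apply: leq_ltn_trans lt_m; rewrite -[leqRHS](subnKC le_km).
  by rewrite leq_add ?leq_mod.
by rewrite -eqC addnC leq_add2l => /leq_trans; apply; apply: sum_leq_nat.
Qed.

Lemma primes_bin_le (m k : nat) : k <= m ->
  size (primes 'C(m, k)) <= size (primes m`!).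
Proof.
move=> le_km; apply: uniq_leq_size (primes_uniq _) _ => p.
rewrite !mem_primes fact_gt0 bin_gt0 le_km /= => /andP[-> dvd_p].
by rewrite -(bin_fact le_km) dvdn_mulr.
Qed.

(** Chebyshev's lower bound: row m of Pascal's triangle sums to 2^m, while each
    of its m+1 entries is a product of at most pi(m) prime powers, all at most m.
    Here pi(m) is the number of prime divisors of m!. *)
Lemma two_exp_le_primes (m : nat) : 2 ^ m <= m.+1 ^ (size (primes m`!)).+1.
Proof.
case: m => [//|m]; set M := m.+1.
have binB k : k <= M -> 'C(M, k) <= M.+1 ^ size (primes M`!).
  move=> le_kM; have C_gt0 : 0 < 'C(M, k) by rewrite bin_gt0.
  rewrite {1}(prod_prime_decomp C_gt0) prime_decompE big_map /=.
  apply: (@leq_trans (\prod_(p <- primes 'C(M, k)) M.+1)).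
    rewrite big_seq [X in _ <= X]big_seq; apply: leq_prod => p.
    rewrite mem_primes => /and3P[p_pr _ _].
    apply: (@leq_trans (p ^ trunc_log p M)).
      by rewrite leq_exp2l ?prime_gt1 // logn_bin_le.
    by apply: leqW; apply: trunc_logP (prime_gt1 p_pr) _.
  by rewrite big_const_seq count_predT iter_muln_1 leq_exp2l ?primes_bin_le.
have -> : 2 = 1 + 1 by [].
rewrite expnDn expnS -[X in _ <= X * _](card_ord M.+1) -sum_nat_const.
apply: leq_sum => i _.
by rewrite !exp1n !muln1 binB // -ltnS.
Qed.

Lemma size_primes_fact_between (k M : nat) : k <= M ->
  size (primes M`!) <= k + count (ltn k) (primes M`!).
Proof.
move=> le_kM; rewrite -(count_predC (ltn k)) addnC leq_add2r -size_filter.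
rewrite -[leqRHS](size_iota 1); apply: uniq_leq_size => [|q].
  by rewrite filter_uniq ?primes_uniq.
rewrite mem_filter mem_iota mem_primes /= -leqNgt add1n ltnS.
by case/and4P => -> /prime_gt0 ->.
Qed.

(** * Many primes just beyond a large number *)

Lemma exp6_lt_two_exp (t : nat) : 60 <= t -> (t + 4) ^ 6 < 2 ^ t.
Proof.
elim: t => [//|t IH]; rewrite leq_eqVlt => /predU1P[<-|le_t].
  have -> : 60 + 4 = 2 ^ 6 by [].
  by rewrite -expnM ltn_exp2l.
have {}IH := IH le_t; rewrite (expnS 2).
(* It suffices that (t + 5)^6 <= 2 (t + 4)^6, and (5/4)^3 < 2. *)
have le2 : 4 * (t + 5) ^ 2 <= 5 * (t + 4) ^ 2 by rewrite !expnS !expn0; nia.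
have : (4 * (t + 5) ^ 2) ^ 3 <= (5 * (t + 4) ^ 2) ^ 3 by rewrite leq_exp2r.
have -> : t.+1 + 4 = t + 5 by lia.
rewrite (expnMn 4 _ 3) (expnMn 5 _ 3) -(expnM _ 2 3) -(expnM _ 2 3) -[2 * 3]/6.
have -> : 4 ^ 3 = 64 by []. have -> : 5 ^ 3 = 125 by [].
move: IH; move: ((t + 4) ^ _) ((t + 5) ^ _) (2 ^ t) => a b c; lia.
Qed.

(** The dilation 2^w must beat a multiple of u, so w is about log u, and still
    satisfy w j < u.  As j <= u^(5/6), the latter follows from w^6 < u.  The
    exponent 6/5 is the simplest one below 11/9 = 20/9 - 1. *)
Lemma exists_dilation (j u : nat) : 60 <= trunc_log 2 u -> j ^ 6 <= u ^ 5 ->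
  exists w, 3 * (u + w + 1) <= 2 ^ w /\ w * j < u.
Proof.
move=> u_big le_ju; have u_gt0 : 0 < u by case: u u_big {le_ju}.
have /andP[le_tu lt_ut] := trunc_log_bounds (isT : 1 < 2) u_gt0.
set t := trunc_log 2 u in le_tu lt_ut.
have lt_tu : t < 2 ^ t by rewrite ltn_expl.
exists (t + 4); split.
  by rewrite expnD; move: lt_ut; rewrite expnS; lia.
rewrite -(ltn_exp2r _ _ (isT : 0 < 6)) expnMn [ltnRHS]expnS.
have lt_wu := leq_trans (exp6_lt_two_exp u_big) le_tu.
apply: leq_ltn_trans (leq_mul (leqnn _) le_ju) _.
by rewrite ltn_mul2r expn_gt0 u_gt0.
Qed.

(** Take M = 2^w k with 2^u <= k < 2^(u+1).  Chebyshev's bound gives at least 2k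
    primes up to M, hence at least k in (k, M], and k >= 2^u > 2^(w j). *)
Lemma many_primes (j U k : nat) : 60 <= trunc_log 2 U -> j ^ 6 <= U ^ 5 -> 2 ^ U <= k ->
  exists2 M, k < M & M ^ j < k ^ j * count (ltn k) (primes M`!).
Proof.
move=> U_big le_jU le_Uk.
have k_gt0 : 0 < k by apply: leq_trans le_Uk; rewrite expn_gt0.
have /andP[le_uk lt_ku] := trunc_log_bounds (isT : 1 < 2) k_gt0.
set u := trunc_log 2 k in le_uk lt_ku.
have le_Uu : U <= u by apply: trunc_log_max.
have [] := @exists_dilation j u (leq_trans U_big (leq_trunc_log 2 le_Uu)).
  by apply: leq_trans le_jU _; rewrite leq_exp2r.
move=> w [le_w lt_wj]; set M := 2 ^ w * k.
have w_ge3 : 3 <= 2 ^ w by apply: leq_trans le_w; lia.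
have lt_kM : k < M by rewrite /M; nia.
exists M => //; rewrite expnMn mulnC ltn_pmul2l ?expn_gt0 ?k_gt0 //.
(* At most k of the primes up to M are at most k. *)
have le_k : k <= count (ltn k) (primes M`!).
  rewrite -(leq_add2l k); apply: leq_trans (size_primes_fact_between (ltnW lt_kM)).
  have := two_exp_le_primes M; set s := size _ => le_s.
  have lt_M : M.+1 <= 2 ^ (u + w + 1).
    rewrite addn1 -addnS addnC expnD expnS.
    by rewrite /M; move: lt_ku w_ge3; rewrite expnS; clear; nia.
  have : 2 ^ M <= 2 ^ ((u + w + 1) * s.+1).
    by apply: leq_trans le_s _; rewrite [leqRHS]expnM leq_exp2r.
  rewrite leq_exp2l // => le_M.
  have : 3 * (u + w + 1) * k <= (u + w + 1) * s.+1.
    by apply: leq_trans le_M; rewrite leq_mul2r le_w orbT.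
  by rewrite mulnAC mulnC leq_pmul2l ?addn1 //; lia.
apply: leq_trans le_k; apply: leq_trans le_uk.
by rewrite -expnM ltn_exp2l.
Qed.

End ManyPrimes.

(** * The divisor function *)

Definition rough (k : nat) : nat_pred := [pred p | (k <= p)%N].

(** A divisor x of m n splits as gcd(x, m) times a divisor of n, and coprimality
    makes d = gcd(d e, m) recoverable from the product. *)
Lemma perm_divisorsM (m n : nat) : (0 < m)%N -> (0 < n)%N -> coprime m n ->
  perm_eq (divisors (m * n)) [seq (d * e)%N | d <- divisors m, e <- divisors n].
Proof.
move=> m_gt0 n_gt0 co_mn; apply: uniq_perm; first exact: divisors_uniq.
  apply: allpairs_uniq; try exact: divisors_uniq.
  move=> [d e] [d' e'] /= /allpairsP[[x y] [/= + + [-> ->]]].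
  rewrite -!dvdn_divisors // => dx ey /allpairsP[[x' y'] [/= + + [-> ->]]].
  rewrite -!dvdn_divisors // => dx' ey' eq_xy.
  have co_my : coprime m y by rewrite coprime_sym (coprime_dvdl ey) // coprime_sym.
  have co_my' : coprime m y' by rewrite coprime_sym (coprime_dvdl ey') // coprime_sym.
  have eq_x : x = x'.
    rewrite -(gcdn_idPr dx) -(Gauss_gcdl x co_my) eq_xy (Gauss_gcdl x' co_my').
    exact/gcdn_idPr.
  move: eq_xy; rewrite -eq_x => /eqP; rewrite eqn_pmul2l ?(dvdn_gt0 m_gt0) //.
  by move/eqP->.
move=> x; rewrite -dvdn_divisors ?muln_gt0 ?m_gt0 //.
apply/idP/allpairsP => [dvd_x|[[d e] /= []]]; last first.
  by rewrite -!dvdn_divisors // => dm en ->; apply: dvdn_mul.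
have g_gt0 : (0 < gcdn x m)%N by rewrite gcdn_gt0 m_gt0 orbT.
exists (gcdn x m, x %/ gcdn x m)%N => /=.
rewrite -!dvdn_divisors // dvdn_gcdr mulnC divnK ?dvdn_gcdl //; split=> //.
rewrite -(dvdn_pmul2l g_gt0) mulnC divnK ?dvdn_gcdl // muln_gcdl dvdn_gcd dvd_x.
by rewrite dvdn_mulr.
Qed.

Section Sigma.
Variables (R : realType) (r : R).
Local Notation sigma := (sigma_neg r).

Lemma sigma_neg1 : sigma 1 = 1.
Proof. by rewrite /sigma_neg /= big_seq1 powR1. Qed.

Lemma sigma_negM (m n : nat) : (0 < m)%N -> (0 < n)%N -> coprime m n ->
  sigma (m * n) = sigma m * sigma n.
Proof.
move=> m_gt0 n_gt0 co_mn; rewrite /sigma_neg (perm_big _ (perm_divisorsM _ _ _)) //=.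
rewrite big_allpairs_dep /= mulr_suml; apply: eq_bigr => d _.
by rewrite mulr_sumr; apply: eq_bigr => e _; rewrite natrM powRM.
Qed.

Lemma sigma_neg_ge_sum (n : nat) (s : seq nat) : (0 < n)%N -> uniq s ->
  {in s, forall d, (d %| n)%N} -> \sum_(d <- s) d%:R `^ (- r) <= sigma n.
Proof.
move=> n_gt0 s_uniq s_dvd; rewrite /sigma_neg.
have eq_s : perm_eq s [seq d <- divisors n | d \in s].
  apply: uniq_perm => // [|d]; first by rewrite filter_uniq ?divisors_uniq.
  rewrite mem_filter -dvdn_divisors //.
  by case: (boolP (d \in s)) => //= /s_dvd ->.
rewrite (perm_big _ eq_s) big_filter [leRHS](bigID (fun d => d \in s)) /=.
by rewrite lerDl; apply: sumr_ge0 => d _; apply: powR_ge0.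
Qed.

Lemma sigma_neg_ge1 (n : nat) : (0 < n)%N -> 1 <= sigma n.
Proof.
move=> n_gt0; have := @sigma_neg_ge_sum n [:: 1%N] n_gt0 isT.
by rewrite big_seq1 powR1; apply => d; rewrite inE => /eqP->; apply: dvd1n.
Qed.

(** The ratio of consecutive values on powers of p is largest for the first step,
    from 1 to p. *)
Lemma sigma_neg_pexpS (p a : nat) : 0 <= r -> prime p ->
  sigma (p ^ a.+1) <= sigma (p ^ a) * (1 + p%:R `^ (- r)).
Proof.
move=> r_ge0 p_pr; have p_gt0 := prime_gt0 p_pr.
have pa_gt0 b : (0 < p ^ b)%N by rewrite expn_gt0 p_gt0.
have -> : sigma (p ^ a.+1) = (p ^ a.+1)%:R `^ (- r) + sigma (p ^ a).
  transitivity (\sum_(d <- (p ^ a.+1)%N :: divisors (p ^ a)) d%:R `^ (- r) : R).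
    apply: perm_big; apply: uniq_perm.
    - exact: divisors_uniq.
    - rewrite /= divisors_uniq andbT -dvdn_divisors //.
      by rewrite dvdn_Pexp2l ?prime_gt1 // ltnn.
    move=> d; rewrite inE -!dvdn_divisors //; apply/idP/orP.
      case/(dvdn_pfactor _ _ p_pr) => b; rewrite leq_eqVlt => /predU1P[->|le_b] ->.
        by left.
      by right; rewrite dvdn_exp2l.
    by case=> [/eqP->//|/dvdn_trans]; apply; rewrite dvdn_exp2l.
  by rewrite big_cons.
rewrite mulrDr mulr1 addrC lerD2l.
apply: (@le_trans _ _ (p%:R `^ (- r))); last first.
  by rewrite ler_peMl ?powR_ge0 ?sigma_neg_ge1.
rewrite !powRN lef_pV2 ?posrE ?powR_gt0 ?ltr0n //.
apply: ge0_ler_powR => //; rewrite ?nnegrE ?ler0n // ler_nat.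
by rewrite -{1}[p]expn1 leq_exp2l ?prime_gt1.
Qed.

(** For r >= 2 the terms are at most 1/(d(d-1)), which telescopes. *)
Lemma sum_powRN_le (N M : nat) : 2 <= r -> (1 < N)%N -> (N <= M)%N ->
  \sum_(N <= d < M) d%:R `^ (- r) <= N.-1%:R^-1 - M.-1%:R^-1.
Proof.
move=> r_ge2 N_gt1; elim: M => [|M IH]; first by case: N N_gt1.
rewrite leq_eqVlt => /predU1P[<-|le_NM]; first by rewrite big_geq // subrr.
rewrite big_nat_recr //=; have {}IH := IH le_NM.
suff : M%:R `^ (- r) <= M.-1%:R^-1 - M%:R^-1 by lra.
have M_gt1 : (1 < M)%N by apply: leq_trans N_gt1 le_NM.
apply: (@le_trans _ _ (M%:R ^- 2)).
  rewrite powRN lef_pV2 ?posrE ?powR_gt0 ?exprn_gt0 ?ltr0n ?(ltnW M_gt1) //.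
  rewrite -powR_mulrn ?ler0n //; apply: ler_powR => //.
  by rewrite ler1n (ltnW M_gt1).
case: M M_gt1 {le_NM IH} => // M; rewrite ltnS => M_gt0 /=.
have m_gt0 : 0 < M%:R :> R by rewrite ltr0n.
rewrite -[M.+1]addn1 natrD; set m := M%:R in m_gt0 *.
have -> : m^-1 - (m + 1)^-1 = (m * (m + 1))^-1.
  by field; apply/andP; split; lra.
rewrite lef_pV2 ?posrE ?exprn_gt0 ?mulr_gt0 //; lra.
Qed.

(** All divisors of an N-rough number other than 1 are at least N.  With N = 2
    this bounds the whole range by 2; as N grows, it makes the greedy remainders
    tend to 1. *)
Lemma sigma_neg_rough_le (N l : nat) : 2 <= r -> (1 < N)%N -> (rough N).-nat l ->
  sigma l <= 1 + N.-1%:R^-1.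
Proof.
move=> r_ge2 N_gt1 rough_l; have l_gt0 : (0 < l)%N by case/andP: rough_l.
rewrite /sigma_neg (bigD1_seq 1%N) ?divisors_uniq ?divisor1 //= powR1 lerD2l.
pose M := maxn N l.+1.
apply: (@le_trans _ _ (\sum_(N <= d < M) d%:R `^ (- r))); last first.
  apply: le_trans (sum_powRN_le _ N_gt1 (leq_maxl _ _)) _ => //.
  by rewrite gerBl invr_ge0 ler0n.
rewrite -big_filter; set s := [seq d <- _ | _].
rewrite [leRHS](bigID (fun d => d \in s)) /=.
rewrite -[leLHS]addr0; apply: lerD; last first.
  by apply: sumr_ge0 => d _; apply: powR_ge0.
have eq_s : perm_eq s [seq d <- index_iota N M | d \in s].
  apply: uniq_perm => [||d]; first by rewrite filter_uniq ?divisors_uniq.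
    by rewrite filter_uniq ?iota_uniq.
  rewrite mem_filter mem_index_iota; case: (boolP (d \in s)) => //=.
  rewrite mem_filter -dvdn_divisors // => /andP[d_neq1 dvd_l].
  rewrite leq_max ltnS (dvdn_leq l_gt0 dvd_l) orbT andbT; symmetry.
  have d_gt0 := dvdn_gt0 l_gt0 dvd_l.
  have d_gt1 : (1 < d)%N by rewrite ltn_neqAle eq_sym d_neq1.
  have := pnatPpi (pnat_dvd dvd_l rough_l) (etrans (pi_pdiv d) d_gt1).
  by move=> /leq_trans; apply; apply: pdiv_leq.
by rewrite (perm_big _ eq_s) big_filter.
Qed.
End Sigma.

(** * Greedy expansion over large primes *)

Lemma prime_dvd_fact_leq (p n : nat) : prime p -> (p %| n`!)%N -> (p <= n)%N.
Proof.
move=> p_pr; elim: n => [|n IH]; first by rewrite dvdn1 => /eqP p1; rewrite p1 in p_pr.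
by rewrite factS Euclid_dvdM // => /orP[/dvdn_leq->//|/IH/leqW].
Qed.

Section Greedy.
Variables (R : realType) (r : R).
Local Notation sigma := (sigma_neg r).

(** Kakeya's condition at k, in multiplicative form: the first factor 1 + k^(-r)
    that k can contribute is exceeded by using only primes beyond k. *)
Definition outweighed (k : nat) :=
  exists2 l, (rough k.+1).-nat l & 1 + k%:R `^ (- r) < sigma l.

(** Take for l the product of the primes in (k, M]: each of them contributes at
    least M^(-r) to sigma_{-r}(l). *)
Lemma outweighed_of_many_primes (j k M : nat) : 0 <= r <= j%:R ->
  (0 < k < M)%N ->
  (M ^ j < k ^ j * count (ltn k) (primes M`!))%N -> outweighed k.
Proof.
move=> /andP[r_ge0 le_rj] /andP[k_gt0 lt_kM]; rewrite -size_filter.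
set s := [seq q <- _ | _] => many.
have s_prime q : q \in s -> [/\ prime q, (k < q)%N & (q <= M)%N].
  rewrite mem_filter mem_primes => /and4P[lt_kq q_pr _ q_dvd]; split=> //.
  exact: prime_dvd_fact_leq.
have [k0 M0] : 0 < k%:R :> R /\ 0 < M%:R :> R by rewrite !ltr0n; lia.
exists (\prod_(q <- s) q)%N.
  rewrite big_seq; elim/big_ind: _ => // [a b na nb|q /s_prime[q_pr lt_kq _]].
    by rewrite pnatM na.
  by rewrite pnatE.
have prod_gt0 : (0 < \prod_(q <- s) q)%N.
  rewrite big_seq; elim/big_ind: _ => // [a b na nb|q /s_prime[/prime_gt0 //]].
  by rewrite muln_gt0 na.
apply: lt_le_trans (@sigma_neg_ge_sum _ r _ (1%N :: s) prod_gt0 _ _); last 2 first.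
- rewrite /= filter_uniq ?primes_uniq // andbT.
  by apply/negP => /s_prime[].
- move=> d; rewrite inE => /predU1P[->|d_s]; first exact: dvd1n.
  by rewrite (big_rem d) //= dvdn_mulr.
rewrite big_cons powR1 ltrD2l.
apply: (@lt_le_trans _ _ (\sum_(q <- s) M%:R `^ (- r))); last first.
  rewrite big_seq [leRHS]big_seq; apply: ler_sum => q /s_prime[q_pr _ le_qM].
  have q0 : 0 < q%:R :> R by rewrite ltr0n prime_gt0.
  rewrite !powRN lef_pV2 ?posrE ?powR_gt0 //.
  by apply: ge0_ler_powR; rewrite ?nnegrE ?ler0n ?ler_nat.
rewrite big_const_seq count_predT iter_addr_0 !powRN -[_ *+ size s]mulr_natr.
rewrite ltr_pdivlMl ?powR_gt0 //.
have -> : M%:R `^ r = (M%:R / k%:R) `^ r * k%:R `^ r :> R.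
  by rewrite -powRM ?divr_ge0 ?ler0n // divfK // gt_eqF.
rewrite mulfK ?gt_eqF ?powR_gt0 //.
apply: (@le_lt_trans _ _ ((M%:R / k%:R) `^ j%:R)).
  by apply: ler_powR => //; rewrite ler_pdivlMr // mul1r ler_nat ltnW.
rewrite powR_mulrn ?divr_ge0 ?ler0n // expr_div_n ltr_pdivrMr ?exprn_gt0 //.
by rewrite -!natrX -natrM ltr_nat mulnC.
Qed.

(** For prime k, the greedy step chooses the power k^b so that t lies between
    sigma(k^b) and what can still be reached from it with primes beyond k.
    Starting from any exponent from which t is reachable, decrease it while
    sigma(k^b) > t: the condition on k says that t remains reachable after each
    decrease. *)
Lemma greedy_step (k : nat) (t : R) : 0 <= r -> outweighed k ->
  1 <= t -> (exists2 l, (rough k).-nat l & t < sigma l) ->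
  exists m, [/\ [pred p | p == k].-nat m, sigma m <= t &
    exists2 l, (rough k.+1).-nat l & t < sigma m * sigma l].
Proof.
move=> r_ge0 [l0 rough_l0 lt_l0] t_ge1 [l rough_l lt_tl].
have l_gt0 : (0 < l)%N by case/andP: rough_l.
case: (boolP (prime k)) => [k_pr|k_npr]; last first.
  exists 1%N; split=> //; rewrite sigma_neg1 //; exists l; rewrite ?mul1r //.
  apply/(pnatP _ l_gt0) => p p_pr dvd_p; rewrite inE ltn_neqAle.
  have := pnatP _ l_gt0 rough_l p p_pr dvd_p; rewrite inE => ->; rewrite andbT.
  by apply: contraNneq k_npr => ->.
have pow_gt0 a : (0 < k ^ a)%N by rewrite expn_gt0 prime_gt0.
have {l l_gt0 rough_l lt_tl} [b [l rough_l lt_t]] :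
    exists b, exists2 l, (rough k.+1).-nat l & t < sigma (k ^ b) * sigma l.
  exists (logn k l), (l`_(negn k))%N; last first.
    rewrite -sigma_negM ?part_gt0 // -p_part ?partnC // coprime_partC //.
  have l'_gt0 := part_gt0 (negn k) l.
  apply/(pnatP _ l'_gt0) => p p_pr dvd_p; rewrite inE ltn_neqAle.
  have := pnatP _ l_gt0 rough_l p p_pr (dvdn_trans dvd_p (dvdn_part _ _)).
  rewrite inE => ->; rewrite andbT.
  have := pnatP _ l'_gt0 (part_pnat (negn k) l) _ p_pr dvd_p.
  by rewrite !inE eq_sym.
elim: b l rough_l lt_t => [|b IH] l rough_l lt_t.
  by exists 1%N; split=> //; [rewrite sigma_neg1|exists l].
have [le_t|gt_t] := leP (sigma (k ^ b.+1)) t.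
  exists (k ^ b.+1)%N; split=> //; last by exists l.
  by rewrite pnatX pnatE // inE eqxx.
apply: (IH l0 rough_l0); apply: lt_le_trans gt_t _.
apply: le_trans (sigma_neg_pexpS _ r_ge0 k_pr) _.
by apply: ler_wpM2l (ltW lt_l0); apply: le_trans (sigma_neg_ge1 _ (pow_gt0 b)).
Qed.

Definition window (P d : nat) : nat_pred := [pred p | (P <= p < P + d)%N].

(** Iterating the step over k = P, ..., P + d - 1 keeps t in the window between
    sigma(n) and what the primes from P + d on can still reach. *)
Lemma greedy_approx (P : nat) (t : R) (d : nat) : 0 <= r -> (0 < P)%N ->
  (forall k, (P <= k)%N -> outweighed k) ->
  1 <= t -> (exists2 l, (rough P).-nat l & t < sigma l) ->
  exists n, [/\ (window P d).-nat n, sigma n <= t &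
    exists2 l, (rough (P + d)).-nat l & t < sigma n * sigma l].
Proof.
move=> r_ge0 P_gt0 outP t_ge1 [l rough_l lt_t]; elim: d => [|d [n]].
  exists 1%N; split; rewrite ?sigma_neg1 //.
  by exists l; rewrite ?addn0 ?mul1r.
case=> win_n le_nt [l' rough_l' lt_nt].
have n_gt0 : (0 < n)%N by case/andP: win_n.
have sn_gt0 : 0 < sigma n by apply: lt_le_trans (sigma_neg_ge1 _ n_gt0).
have [] := @greedy_step (P + d) (t / sigma n) r_ge0.
- by apply: outP; rewrite leq_addr.
- by rewrite ler_pdivlMr ?mul1r.
- by exists l'; rewrite ?ltr_pdivrMr // mulrC.
move=> m [m_nat le_m [l'' rough_l'' lt_l'']].
have m_gt0 : (0 < m)%N by case/andP: m_nat.
have co_nm : coprime n m.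
  apply: (pnat_coprime win_n); apply: sub_in_pnat m_nat => p _.
  by rewrite !inE => /eqP->; rewrite ltnn andbF.
exists (n * m)%N; rewrite sigma_negM //; split.
- rewrite pnatM; apply/andP; split.
    apply: sub_in_pnat win_n => p _; rewrite !inE => /andP[->] /=.
    by rewrite addnS => /leqW.
  apply: sub_in_pnat m_nat => p _; rewrite !inE => /eqP->.
  by rewrite leq_addr addnS leqnn.
- by rewrite mulrC -ler_pdivlMr.
- exists l''; first by rewrite addnS.
  by rewrite -mulrA mulrC -ltr_pdivrMr.
Qed.

(** The ratio of t to its greedy approximation sigma(n) is at most sigma(l') for
    some (P + d)-rough l', hence tends to 1 as d grows; n is coprime to m, so
    sigma(m) sigma(n) is in the range. *)
Lemma closure_sigma_range_mul (P m l : nat) (t : R) : 2 <= r -> (1 < P)%N ->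
  (forall k, (P <= k)%N -> outweighed k) ->
  (negn (rough P)).-nat m -> (rough P).-nat l -> 1 <= t < sigma l ->
  closure (sigma_range r) (sigma m * t).
Proof.
move=> r_ge2 P_gt1 outP m_nat rough_l /andP[t_ge1 lt_tl].
have m_gt0 : (0 < m)%N by case/andP: m_nat.
have sm_ge1 := sigma_neg_ge1 r m_gt0.
have r_ge0 : 0 <= r by lra.
move=> B /nbhs_ballP[e /= e_gt0 ballB].
pose c := sigma m * t; pose d := Num.bound (c / e).
have c_ge0 : 0 <= c by rewrite /c mulr_ge0 //; lra.
have [n [win_n le_nt [l' rough_l' lt_nt]]] :=
  @greedy_approx P t d r_ge0 (ltnW P_gt1) outP t_ge1
    (ex_intro2 _ _ l rough_l lt_tl).
have n_gt0 : (0 < n)%N by case/andP: win_n.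
have sn_ge1 := sigma_neg_ge1 r n_gt0.
have co_mn : coprime m n.
  rewrite coprime_sym; apply: (pnat_coprime (pi := rough P)) m_nat.
  by apply: sub_in_pnat win_n => p _; rewrite !inE => /andP[].
exists (sigma (m * n)); split; first by exists (m * n)%N; rewrite //= muln_gt0 m_gt0.
apply: ballB; rewrite /ball /= sigma_negM // -mulrBr normrM.
rewrite !ger0_norm ?subr_ge0 ?(le_trans _ sm_ge1) //.
have tail := sigma_neg_rough_le r_ge2 (leq_trans P_gt1 (leq_addr d P)) rough_l'.
have lt_d : c / e < (P + d).-1%:R.
  apply: lt_le_trans (archi_boundP _) _; first by rewrite divr_ge0 // ltW.
  by rewrite ler_nat -/d; move: (d) P_gt1; clear; lia.
have N_gt0 : 0 < (P + d).-1%:R :> R.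
  by rewrite ltr0n; move: (d) P_gt1; clear; lia.
apply: (@le_lt_trans _ _ (c / (P + d).-1%:R)); last first.
  by rewrite ltr_pdivrMr // mulrC -ltr_pdivrMr.
rewrite /c -mulrA; apply: ler_wpM2l; first lra.
have : sigma n * sigma l' <= sigma n * (1 + (P + d).-1%:R^-1).
  by apply: ler_wpM2l tail; lra.
have : sigma n * (P + d).-1%:R^-1 <= t * (P + d).-1%:R^-1.
  by apply: ler_wpM2r le_nt; rewrite invr_ge0 ltW.
rewrite mulrDr mulr1; lra.
Qed.

(** With l the P-rough part of n and m its cofactor, the segment runs from
    sigma(m) to sigma(m) times the larger of sigma(l) and sigma(l0), where
    sigma(l0) > 1 + P^(-r): the first choice makes it reach sigma(n), the second
    makes it long. *)
Lemma long_segment (P n : nat) : 2 <= r -> (1 < P)%N ->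
  (forall k, (P <= k)%N -> outweighed k) -> (0 < n)%N ->
  exists u v, [/\ 1 <= u, v <= 2, u + P%:R `^ (- r) <= v,
    `[u, v]%classic (sigma n) & `[u, v] `<=` closure (sigma_range r)].
Proof.
move=> r_ge2 P_gt1 outP n_gt0; have r_ge0 : 0 <= r by lra.
have P_gt0 : (0 < P)%N by lia.
pose m := (n`_(negn (rough P)))%N; pose l := (n`_(rough P))%N.
have m_nat : (negn (rough P)).-nat m by apply: part_pnat.
have rough_l : (rough P).-nat l by apply: part_pnat.
have [m_gt0 l_gt0] : (0 < m)%N /\ (0 < l)%N by rewrite !part_gt0.
have eq_n : (l * m)%N = n by apply: partnC.
clearbody m l.
have [sm_ge1 sl_ge1] := (sigma_neg_ge1 r m_gt0, sigma_neg_ge1 r l_gt0).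
have range_ml l' : (rough P).-nat l' ->
    sigma_range r (sigma m * sigma l') /\ sigma m * sigma l' <= 2.
  move=> rough_l'; have l'_gt0 : (0 < l')%N by case/andP: rough_l'.
  have ml_gt0 : (0 < m * l')%N by rewrite muln_gt0 m_gt0.
  rewrite -sigma_negM //; last by rewrite coprime_sym (pnat_coprime rough_l').
  split; first by exists (m * l')%N.
  have /(sigma_neg_rough_le r_ge2 (isT : (1 < 2)%N)) : (rough 2).-nat (m * l')%N.
    by apply/pnatP => // p p_pr _; apply: prime_gt1.
  by rewrite invr1; lra.
have segment l' : (rough P).-nat l' ->
    `[sigma m, sigma m * sigma l'] `<=` closure (sigma_range r).
  move=> rough_l' x /=; rewrite in_itv /= => /andP[le_mx].
  rewrite le_eqVlt => /predU1P[->|lt_x].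
    by apply: subset_closure; have [] := range_ml _ rough_l'.
  have sm_gt0 : 0 < sigma m by lra.
  rewrite -[x](divfK (lt0r_neq0 sm_gt0)) mulrC.
  apply: (@closure_sigma_range_mul P m l') => //.
  by rewrite ler_pdivlMr // mul1r le_mx ltr_pdivrMr // mulrC.
have sn : sigma n = sigma m * sigma l.
  by rewrite mulrC -sigma_negM ?eq_n // (pnat_coprime rough_l m_nat).
have [l0 rough_l0 lt_l0] := outP P (leqnn P).
have {}rough_l0 : (rough P).-nat l0.
  by apply: sub_in_pnat rough_l0 => p _; rewrite !inE => /ltnW.
suff [l' [rough_l' le_l' le_l0]] :
    exists l', [/\ (rough P).-nat l', sigma l <= sigma l' & sigma l0 <= sigma l'].
  exists (sigma m), (sigma m * sigma l'); split=> //.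
  - by have [] := range_ml _ rough_l'.
  - have : sigma m * (1 + P%:R `^ (- r)) <= sigma m * sigma l'.
      by apply: ler_wpM2l; lra.
    have : P%:R `^ (- r) <= sigma m * P%:R `^ (- r) by rewrite ler_peMl ?powR_ge0.
    rewrite mulrDr; lra.
  - rewrite /= in_itv /= sn; apply/andP; split.
      by rewrite ler_peMr //; lra.
    by apply: ler_wpM2l => //; lra.
  - exact: segment.
by have [le_l|/ltW le_l] := leP (sigma l) (sigma l0); [exists l0|exists l].
Qed.
End Greedy.

(** * Counting components *)

(** Every segment contains one of the D points a + i delta with i < D.  The
    components through these points form a finite family of closed sets covering
    A, hence its closure, so there is no other component. *)
Lemma counting_components_closure_le (R : realType) (A : set R) (a b delta : R)
    (D : nat) : 0 < delta -> b < a + D%:R * delta ->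
  (forall x, A x -> exists u v, [/\ a <= u, v <= b, u + delta <= v,
     `[u, v]%classic x & `[u, v] `<=` closure A]) ->
  (counting (components (closure A)) <= (D%:R : R)%:E)%E.
Proof.
move=> delta_gt0 lt_bD long; set K := closure A.
pose g (i : nat) : R := a + i%:R * delta.
have K_closed : closed K by apply: closed_closure.
have sub_grid : K `<=` \bigcup_(i in `I_D) connected_component K (g i).
  have /closure_id -> : closed (\bigcup_(i in `I_D) connected_component K (g i)).
    by apply: closed_bigcup => // i _; apply: component_closed.
  apply: closureS => x /long[u [v [le_au le_vb le_uv x_uv uv_K]]].
  pose i := (Num.trunc ((u - a) / delta)).+1.
  have q_ge0 : 0 <= (u - a) / delta by rewrite divr_ge0 ?subr_ge0 // ltW.
  have /andP[le_i lt_i] := truncn_itv q_ge0.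
  have lt_ui : u < g i by rewrite /g -ltrBlDl -ltr_pdivrMr.
  have le_iv : g i <= u + delta.
    by rewrite /g -natr1 mulrDl mul1r addrA lerD2r -lerBrDl -ler_pdivlMr.
  exists i => /=.
    rewrite -(ltr_nat R) -(ltr_pM2r delta_gt0).
    by move: lt_bD le_iv; rewrite /g; lra.
  apply: (connected_component_max (B := `[u, v])) => //.
  - by rewrite /= in_itv /=; apply/andP; split; lra.
  - exact: segment_connected.
have comp_le : (components K #<= `I_D)%card.
  apply: (@card_le_trans _ _ _ ((connected_component K \o g) @` `I_D)).
    apply: subset_card_le => _ [x /sub_grid[i i_lt gi_x] <-].
    by exists i => //=; apply: same_connected_component.
  exact: card_image_le.
rewrite /counting asboolT; last by apply: card_le_finite comp_le _.
by rewrite lee_fin ler_nat; apply: geq_card_fset_set.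
Qed.

Lemma nb_components_le (R : realType) (r : R) (j U : nat) : 2 <= r <= j%:R ->
  (60 <= trunc_log 2 U)%N -> (j ^ 6 <= U ^ 5)%N ->
  (nb_components r <= ((2 ^+ (U * j).+1)%:E : \bar R))%E.
Proof.
move=> /andP[r_ge2 le_rj] U_big le_jU; pose P := (2 ^ U)%N.
have P_gt1 : (1 < P)%N.
  have U_gt0 : (0 < U)%N by case: U U_big {le_jU P}.
  by rewrite /P -(expn0 2) ltn_exp2l.
have outP k : (P <= k)%N -> outweighed r k.
  move=> le_Pk; have [M lt_kM many] := many_primes U_big le_jU le_Pk.
  apply: (@outweighed_of_many_primes _ _ j k M) => //.
    by rewrite le_rj andbT; lra.
  by rewrite lt_kM andbT; apply: leq_trans le_Pk; apply: ltnW.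
have P_gt0 : 0 < P%:R :> R by rewrite ltr0n ltnW.
rewrite -natrX; apply: (@counting_components_closure_le _ _ 1 2 (P%:R `^ (- r))).
- by rewrite powR_gt0.
- have le_P : P%:R `^ r <= (2 ^ (U * j))%:R :> R.
    rewrite expnM natrX -powR_mulrn ?ler0n //; apply: ler_powR => //.
    by rewrite ler1n ltnW.
  rewrite powRN -[X in X < _]/(1 + 1) ltrD2l ltr_pdivlMr ?powR_gt0 // mul1r.
  apply: le_lt_trans le_P _; rewrite ltr_nat ltn_exp2l //.
- by move=> _ [n /= n_gt0 <-]; apply: long_segment.
Qed.

(** * Comparison with the required bound *)

Lemma two_exp_le_expR (R : realType) (n : nat) : 2 ^+ n <= expR (n%:R : R).
Proof.
rewrite -[n%:R]mulr1 expRM_natl lerXn2r ?nnegrE ?expR_ge0 ?ler0n //.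
by have := expR_ge1Dx (1 : R); lra.
Qed.

(** The gap 20/9 - 11/5 = 1/45 leaves room for s^2 with s = r^(1/90): one factor s
    absorbs constants, the other the logarithm, because ln r <= 360 r^(1/360)
    gives (ln r)^(29/9) <= (ln r)^4 <= 360^4 s. *)
Lemma exponent_le (R : realType) (r : R) : expR 1 <= r -> (64 * 360 ^+ 4) ^+ 90 <= r ->
  64 * r `^ (11 / 5) <= r `^ (20 / 9) / ln r `^ (29 / 9).
Proof.
move=> r_e r_big; have r_gt0 : 0 < r by apply: lt_le_trans r_e; apply: expR_gt0.
have r_ge1 : 1 <= r by apply: le_trans r_e; have := expR_ge1Dx (1 : R); lra.
have ln_ge1 : 1 <= ln r by rewrite -(expRK 1) ler_ln ?posrE ?expR_gt0.
have ln_gt0 : 0 < ln r by lra.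
set q := r `^ 360^-1; set s := r `^ 90^-1.
have q_gt0 : 0 < q by apply: powR_gt0.
have s_gt0 : 0 < s by apply: powR_gt0.
have s_q : s = q ^+ 4.
  by rewrite -powR_mulrn ?(ltW q_gt0) // /q -powRrM; congr (_ `^ _); field.
have r_s : r = s ^+ 90.
  by rewrite -powR_mulrn ?(ltW s_gt0) // /s -powRrM mulVf ?powRr1 // ltW.
have ln_q : ln r = 360 * ln q by rewrite /q ln_powR; field.
(* Replacing 360 by a variable keeps its powers from being computed. *)
have c_gt0 : 0 < 360 :> R by rewrite ltr0n.
move: (360 : R) c_gt0 ln_q r_big => c c_gt0 ln_q r_big.
have le_Cs : 64 * c ^+ 4 <= s.
  have C_ge0 : 0 <= 64 * c ^+ 4 by rewrite mulr_ge0 ?exprn_ge0 ?(ltW c_gt0).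
  by rewrite -(@ler_pXn2r _ 90) ?nnegrE ?(ltW s_gt0) // -r_s.
have le_ln : ln r <= c * q.
  by rewrite ln_q (ler_pM2l c_gt0); apply: ltW; apply: ln_sublinear.
have le_ln4 : ln r `^ (29 / 9) <= c ^+ 4 * s.
  apply: (@le_trans _ _ (ln r ^+ 4)).
    by rewrite -powR_mulrn ?(ltW ln_gt0) //; apply: ler_powR => //; lra.
  rewrite s_q -exprMn lerXn2r ?nnegrE ?(ltW ln_gt0) //.
  by rewrite mulr_ge0 ?(ltW c_gt0) ?(ltW q_gt0).
have -> : r `^ (20 / 9) = r `^ (11 / 5) * (s * s).
  by rewrite /s -!powRD ?(gt_eqF r_gt0) ?implybT //; congr (_ `^ _); field.
rewrite ler_pdivlMr ?powR_gt0 // -mulrA mulrCA.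
apply: ler_wpM2l; first exact: powR_ge0.
have : s * (64 * c ^+ 4) <= s * s by rewrite (ler_pM2l s_gt0).
lra.
Qed.

Theorem theorem3p8 (R : realType) :
  exists A R0 : R, [/\ 0 < A, 1 < R0 &
    forall r : R, R0 <= r ->
      (nb_components r <=
       (2^-1 * expR (2^-1 * (r `^ (20 / 9) / ln r `^ (29 / 9)) *
          (1 + ln (ln r) / (ln r - ln (ln r)) + A / ln r)))%:E)%E].
Proof.
pose R0 : R := Num.max (expR 1) (Num.max (2 ^+ 60) ((64 * 360 ^+ 4) ^+ 90)).
have e_ge2 : 2 <= expR 1 :> R by have := expR_ge1Dx (1 : R); lra.
exists 1, R0; split=> //; first by rewrite /R0 lt_max; apply/orP; left; lra.
move=> r; rewrite /R0 !ge_max => /and3P[r_e r_60 r_big].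
have r_ge2 : 2 <= r by lra.
have r_gt0 : 0 < r by lra.
have ln_ge1 : 1 <= ln r by rewrite -(expRK 1) ler_ln ?posrE ?expR_gt0.
have X_ge := exponent_le r_e r_big; clear r_big.
(* Integers j just above r and U just above j^(6/5). *)
pose j := (Num.trunc r).+1; pose y : R := j%:R `^ (6 / 5); pose U := (Num.trunc y).+1.
have /andP[le_jr lt_rj] := truncn_itv (ltW r_gt0).
have y_ge0 : 0 <= y by apply: powR_ge0.
have /andP[le_Uy lt_yU] := truncn_itv y_ge0.
have {}lt_rj : r < j%:R by [].
have {}lt_yU : y < U%:R by [].
have {}le_jr : j%:R <= r + 1 by rewrite /j -natr1 lerD2r.
have {}le_Uy : U%:R <= y + 1 by rewrite /U -natr1 lerD2r.
clearbody U j.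
have j_ge1 : 1 <= j%:R :> R by lra.
have le_jy : j%:R <= y by rewrite -[leLHS]powRr1 ?ler0n //; apply: ler_powR => //; lra.
have y5 : y ^+ 5 = j%:R ^+ 6.
  by rewrite -!powR_mulrn ?ler0n // -powRrM; congr (_ `^ _); field.
have le_jU : (j ^ 6 <= U ^ 5)%N.
  by rewrite -(ler_nat R) !natrX -y5 lerXn2r ?nnegrE ?ler0n // ltW.
have U_big : (60 <= trunc_log 2 U)%N.
  by apply: trunc_log_max; rewrite // -(ler_nat R) natrX; lra.
apply: le_trans (nb_components_le _ U_big le_jU) _; first by rewrite r_ge2 ltW.
(* The correction factor only helps: it is at least 1. *)
rewrite lee_fin; set Y := 1 + _ + _.
have Y_ge1 : 1 <= Y.
  have ll_ge0 : 0 <= ln (ln r) by apply: ln_ge0.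
  have lt_ll : ln (ln r) < ln r by apply: ln_sublinear; lra.
  have : 0 <= ln (ln r) / (ln r - ln (ln r)) by rewrite divr_ge0 ?subr_ge0 // ltW.
  have : 0 <= 1 / ln r by rewrite divr_ge0 //; lra.
  by rewrite /Y; lra.
set X := r `^ _ / _ in X_ge *.
have le_Uj : U%:R * j%:R + 2 <= 32 * r `^ (11 / 5).
  have yj : y * j%:R = j%:R `^ (11 / 5).
    rewrite -[X in _ * X]powRr1 ?ler0n // -powRD.
      by congr (_ `^ _); field.
    by apply/implyP => _; apply: lt0r_neq0; lra.
  have le_j2 : j%:R `^ (11 / 5) <= 8 * r `^ (11 / 5).
    apply: (@le_trans _ _ ((2 * r) `^ (11 / 5))).
      by apply: ge0_ler_powR; rewrite ?nnegrE ?ler0n //; lra.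
    rewrite powRM //; last lra.
    apply: ler_wpM2r; first exact: powR_ge0.
    apply: (@le_trans _ _ (2 `^ 3%:R)); first by apply: ler_powR; lra.
    by rewrite powR_mulrn //; lra.
  have : U%:R * j%:R <= (y + 1) * j%:R by apply: ler_wpM2r le_Uy; rewrite ler0n.
  have : 1 <= y * j%:R by rewrite mulr_ege1 // (le_trans j_ge1).
  have : j%:R <= y * j%:R by rewrite ler_peMl ?ler0n //; lra.
  rewrite mulrDl mul1r yj; lra.
apply: le_trans (two_exp_le_expR _ _) _.
(* The factor 1/2 is paid for by one unit in the exponent, as e >= 2. *)
rewrite -(@ler_pM2l _ 2) // mulrA divff // mul1r.
apply: (@le_trans _ _ (expR 1 * expR (U * j).+1%:R)).
  by rewrite ler_pM2r ?expR_gt0.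
rewrite -expRD ler_expR -natr1 natrM.
have w_ge0 := powR_ge0 r (11 / 5).
have : 2^-1 * X <= 2^-1 * X * Y by rewrite ler_peMr //; lra.
lra.
Qed.
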